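(* Let $I=(A,\succ,c)$ be an SF instance and let $w,w'$ be two stable half-matchings of $I$. Then for every agent $a_i\in A$, $\sum_{a_j\in A,\,j\neq i}w(\{a_i,a_j\})=\sum_{a_j\in A,\,j\neq i}w'(\{a_i,a_j\})$.
   Context: A Stable Fixtures (SF) instance is $I=(A,\succ,c)$ where $A=\{a_1,\dots,a_n\}$ is a finite set of $n$ agents; each agent $a_i$ has a strict linear order $\succ_i$ over $A\setminus\{a_i\}$ (complete preference list), with the convention that every agent ranks itself last; $a\succeq_i b$ means $a\succ_i b$ or $a=b$. Each agent has an integer capacity $c_i$ with $1\le c_i<n$. A half-matching of $I$ is a function $w$ from unordered pairs of distinct agents to $\{0,\tfrac12,1\}$ with $\sum_{j\neq i}w(\{a_i,a_j\})\le c_i$ for all $i$. Agent $a_k$ ranks pairs containing it by the rank of the other agent: $\{a_k,a_l\}\succeq_k\{a_k,a_m\}$ iff $a_l\succeq_k a_m$. $w$ is stable if for every pair $e=\{a_i,a_j\}$ of distinct agents, either $w(e)=1$ or there is $a_k\in e$ with $\sum_{f\ni a_k,\ f\succeq_k e}w(f)=c_k$. *)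

(* Defs.v *)
From mathcomp Require Import all_boot all_order all_algebra.
Set Implicit Arguments.
Unset Strict Implicit.
Unset Printing Implicit Defensive.
Import Order.TTheory GRing.Theory Num.Theory.
Local Open Scope ring_scope.

(* [prefers a b c] reads "b is strictly better than c for a".  The strict
   linear order of a on A \ {a}, together with the convention that a ranks
   itself last, is a strict linear order on all of A with last element a. *)
Record sf_instance (A : finType) := SFInstance {
  prefers : A -> rel A;
  capacity : A -> nat;
  prefers_irr : forall a, irreflexive (prefers a);
  prefers_trans : forall a, transitive (prefers a);
  prefers_total : forall a b c, b != c -> prefers a b c || prefers a c b;
  prefers_self_last : forall a b, b != a -> prefers a b a;
  capacity_bounds : forall a, (1 <= capacity a < #|A|)%N
}.

Definition weakly_prefers (A : finType) (I : sf_instance A) (a b c : A) : bool :=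
  prefers I a b c || (b == c).

(* An unordered pair of distinct agents is a two-element set, so a function on
   such pairs is given by a function on {set A}; no definition below looks at
   its values on sets that do not have exactly two elements. *)
Definition half_matching (A : finType) (I : sf_instance A)
    (w : {set A} -> rat) : Prop :=
  (forall e : {set A}, #|e| = 2 -> w e \in [:: 0; 1 / 2%:R; 1]) /\
  (forall a : A, \sum_(b | b != a) w [set a; b] <= (capacity I a)%:R).

(* True only when e and f are pairs of distinct agents, both containing k. *)
Definition weakly_prefers_pair (A : finType) (I : sf_instance A) (k : A)
    (f e : {set A}) : bool :=
  [exists l : A, exists m : A,
    [&& l != k, m != k, f == [set k; l], e == [set k; m]
      & weakly_prefers I k l m]].

Definition stable (A : finType) (I : sf_instance A) (w : {set A} -> rat) : Prop :=
  forall e : {set A}, #|e| = 2 ->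
    w e = 1 \/
    exists2 k : A, k \in e &
      \sum_(f : {set A} | weakly_prefers_pair I k f e) w f = (capacity I k)%:R.

Definition stable_half_matching (A : finType) (I : sf_instance A)
    (w : {set A} -> rat) : Prop :=
  half_matching I w /\ stable I w.

(* Main.v *)
(** Put z = w - w'.  Where z(e) > 0, stability of w' makes w' saturate an
    endpoint of e with pairs at least as good as e; call such endpoints
    w'-blockers, and define w-blockers symmetrically on z < 0.  No agent is both,
    because the two blocked pairs would each have to be better than the other.
    Let s be -1 on w'-blockers, 1 on w-blockers and 0 elsewhere.  A w'-blocker
    is saturated by w', a w-blocker by w, so s(a) * sum_b z(a,b) >= 0 for every
    a; while (s(a) + s(b)) * z(a,b) <= 0 for every pair, since a pair with
    z > 0 has an endpoint where s = -1 and dually.  Summing over all ordered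
    pairs forces equality everywhere. *)
Require Import Defs.
From mathcomp Require Import all_boot all_order all_algebra.
Import Order.TTheory GRing.Theory Num.Theory.
Local Open Scope ring_scope.

(** Double counting: since [z] is symmetric, summing [(s a + s b) * z a b] over ordered pairs gives
    twice the sum of [s a * \sum_b z a b]. One side is nonpositive and the other nonnegative, so
    every term on each side vanishes. *)
Lemma signed_sums_eq0 (R : realDomainType) (A : finType) (z : A -> A -> R)
    (s : A -> R) :
  (forall a b, z a b = z b a) ->
  (forall a, 0 <= s a * \sum_b z a b) ->
  (forall a b, (s a + s b) * z a b <= 0) ->
  (forall a b, z a b != 0 -> (s a != 0) || (s b != 0)) ->
  forall a, \sum_b z a b = 0.
Proof.
move=> zC s_ge0 s_le0 s_neq0.
have sumE : \sum_a \sum_b (s a + s b) * z a b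
    = (\sum_a s a * \sum_b z a b) *+ 2.
  rewrite mulr2n.
  under eq_bigr do under eq_bigr do rewrite mulrDl.
  under eq_bigr do rewrite big_split /= -mulr_sumr.
  rewrite big_split /=; congr (_ + _).
  rewrite exchange_big /=; apply: eq_bigr => a _; rewrite mulr_sumr.
  by apply: eq_bigr => b _; rewrite zC.
have sum_eq0 : \sum_a s a * \sum_b z a b = 0.
  apply/eqP; rewrite eq_le sumr_ge0 // andbT -(pmulrn_lle0 _ (isT : (0 < 2)%N)) -sumE.
  by apply: sumr_le0 => a _; apply: sumr_le0.
have pair_eq0 a b : (s a + s b) * z a b = 0.
  apply/eqP; rewrite -oppr_eq0; apply/eqP.
  have := sumE; rewrite sum_eq0 mul0rn pair_big /=.
  move=> /eqP; rewrite -oppr_eq0 -sumrN => /eqP.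
  by move/psumr_eq0P => /(_ _ (a, b) isT); apply => i _; rewrite oppr_ge0.
(* A nonzero [s a] cancels from its vanishing term. If [s a = 0], a nonzero [z a b] would force
   [s b != 0] and hence a nonzero pair term, so the whole row of [a] is zero. *)
move=> a; have [sa0|sa_neq0] := eqVneq (s a) 0.
  rewrite big1 // => b _; apply/eqP; apply: contraT => z_neq0.
  have := s_neq0 a b z_neq0; rewrite sa0 eqxx /=.
  by have /eqP := pair_eq0 a b; rewrite sa0 add0r mulf_eq0 (negPf z_neq0) orbF => ->.
have /psumr_eq0P/(_ sum_eq0)/(_ a isT)/eqP : forall i : A, true -> 0 <= s i * \sum_b z i b by [].
by rewrite mulf_eq0 (negPf sa_neq0) => /eqP.
Qed.

Section Domination.

Set Implicit Arguments.
Unset Strict Implicit.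

Variables (A : finType) (I : sf_instance A).
Implicit Types (w v : {set A} -> rat) (a b k l : A).

(** The saturation alternative of [stable] at the endpoint [k] of {k, b}, indexed by partners rather
    than by two-element sets. *)
Definition dominated w k b : bool :=
  \sum_(l | (l != k) && weakly_prefers I k l b) w [set k; l]
    == (capacity I k)%:R.

Definition blocker w v a : bool :=
  [exists b, [&& b != a, w [set a; b] < v [set a; b] & dominated w a b]].

Lemma set2_inj k l m : l != k -> m != k -> [set k; l] = [set k; m] -> l = m.
Proof.
move=> lk mk /setP/(_ l).
by rewrite !inE eqxx orbT (negPf lk) /= => /esym/eqP.
Qed.

Lemma weakly_prefers_pairE k b f : b != k ->
  weakly_prefers_pair I k f [set k; b] =
  (f \in [set [set k; l] | l in [set l | (l != k) && weakly_prefers I k l b]]).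
Proof.
move=> bk; apply/existsP/imsetP => [[l /existsP[m]]|[l]].
  case/and5P=> lk mk /eqP -> /eqP eqbm lm; exists l => //.
  by rewrite inE lk (set2_inj bk mk eqbm).
rewrite inE => /andP[lk lb] ->; exists l; apply/existsP; exists b.
by rewrite lk bk !eqxx.
Qed.

Lemma sum_weakly_prefers_pair w k b : b != k ->
  \sum_(f | weakly_prefers_pair I k f [set k; b]) w f
    = \sum_(l | (l != k) && weakly_prefers I k l b) w [set k; l].
Proof.
move=> bk; under eq_bigl do rewrite (weakly_prefers_pairE _ bk).
rewrite big_imset /=; first by apply: eq_bigl => l; rewrite inE.
move=> l m; rewrite !inE => /andP[lk _] /andP[mk _]; exact: set2_inj.
Qed.

Lemma half_matching_bounds w k l : half_matching I w -> l != k ->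
  0 <= w [set k; l] <= 1.
Proof.
case=> w_val _ lk; have := w_val [set k; l].
by rewrite cards2 eq_sym lk => /(_ erefl); rewrite !inE => /or3P[] /eqP ->.
Qed.

Lemma stable_dominated w a b : stable I w -> b != a -> w [set a; b] < 1 ->
  dominated w a b || dominated w b a.
Proof.
move=> w_st ba w_lt1; have := w_st [set a; b].
rewrite cards2 eq_sym ba => /(_ erefl) [w1|[k]]; first by rewrite w1 ltxx in w_lt1.
rewrite !inE => /orP[] /eqP ->.
  by rewrite sum_weakly_prefers_pair // => /eqP; rewrite /dominated => ->.
rewrite setUC sum_weakly_prefers_pair 1?eq_sym // => /eqP.
by rewrite /dominated => ->; rewrite orbT.
Qed.

(** Partners at least as good as [b] already use up the capacity of [k]; as values are nonnegative,
    nothing is left for worse partners. *)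
Lemma dominated_saturated w k b : half_matching I w -> dominated w k b ->
  \sum_(l | l != k) w [set k; l] = (capacity I k)%:R
  /\ forall d, d != k -> ~~ weakly_prefers I k d b -> w [set k; d] = 0.
Proof.
move=> w_hm /eqP dom; have [_ /(_ k)] := w_hm.
rewrite (bigID (fun l => weakly_prefers I k l b)) /= dom gerDl => rest_le0.
have w_ge0 l : (l != k) && ~~ weakly_prefers I k l b -> 0 <= w [set k; l].
  by case/andP=> lk _; case/andP: (half_matching_bounds w_hm lk).
have rest0 : \sum_(l | (l != k) && ~~ weakly_prefers I k l b) w [set k; l] = 0.
  by apply/eqP; rewrite eq_le rest_le0 sumr_ge0.
split=> [|d dk db]; first by rewrite rest0 addr0.
by apply: (psumr_eq0P w_ge0 rest0); rewrite dk.
Qed.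

Lemma blocker_saturated w v k : half_matching I w -> blocker w v k ->
  \sum_(l | l != k) w [set k; l] = (capacity I k)%:R.
Proof.
by move=> w_hm /existsP[b /and3P[_ _ /(dominated_saturated w_hm)[]]].
Qed.

Lemma weakly_prefers_antisym k b d :
  weakly_prefers I k b d -> weakly_prefers I k d b -> b = d.
Proof.
case/orP=> [bd|/eqP //] /orP[db|/eqP //].
by have := prefers_trans bd db; rewrite prefers_irr.
Qed.

Lemma blocker_disjoint w v k : half_matching I w -> half_matching I v ->
  blocker w v k -> ~~ blocker v w k.
Proof.
move=> w_hm v_hm /existsP[b /and3P[bk wv_b dom_b]].
apply/existsP => -[d /and3P[dk vw_d dom_d]].
have [_ w0] := dominated_saturated w_hm dom_b.
have [_ v0] := dominated_saturated v_hm dom_d.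
have /andP[w_ge0 _] := half_matching_bounds w_hm bk.
have /andP[v_ge0 _] := half_matching_bounds v_hm dk.
(* From [0 <= v < w] on {k, d}, [w] is positive there, whereas it vanishes on partners worse than
   [b]. The same argument with the roles exchanged gives [bd]. *)
have db : weakly_prefers I k d b.
  by apply: contraT => /(w0 _ dk) wd0; rewrite wd0 ltNge v_ge0 in vw_d.
have bd : weakly_prefers I k b d.
  by apply: contraT => /(v0 _ bk) vb0; rewrite vb0 ltNge w_ge0 in wv_b.
(* The two witnesses coincide, so the strict inequalities [wv_b] and [vw_d] contradict each other on
   one pair. *)
have eq_bd := weakly_prefers_antisym bd db.
by rewrite eq_bd ltNge ltW in wv_b.
Qed.

(** The bound [v <= 1] gives [w < 1] on the pair, which rules out the first alternative of
    stability. *)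
Lemma stable_blocker w v a b : stable_half_matching I w -> half_matching I v ->
  b != a -> w [set a; b] < v [set a; b] -> blocker w v a || blocker w v b.
Proof.
move=> [_ w_st] v_hm ba wv.
have /andP[_ v_le1] := half_matching_bounds v_hm ba.
have /orP[dom|dom] := stable_dominated w_st ba (lt_le_trans wv v_le1).
  by apply/orP; left; apply/existsP; exists b; rewrite ba wv.
by apply/orP; right; apply/existsP; exists a; rewrite eq_sym ba setUC wv.
Qed.

End Domination.

Theorem theorem8 (A : finType) (I : sf_instance A) (w w' : {set A} -> rat)
    (hw : stable_half_matching I w) (hw' : stable_half_matching I w') (a : A) :
  \sum_(b | b != a) w [set a; b] = \sum_(b | b != a) w' [set a; b].
Proof.
have [w_hm _] := hw; have [w'_hm _] := hw'.
(* The diagonal is set to 0 because the values of [w] and [w'] on singletons are arbitrary. *)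
pose z a b := if b != a then w [set a; b] - w' [set a; b] else 0.
pose s a : rat := (blocker I w w' a)%:R - (blocker I w' w a)%:R.
have sum_z k : \sum_b z k b
    = \sum_(b | b != k) w [set k; b] - \sum_(b | b != k) w' [set k; b].
  by rewrite -sumrB [RHS]big_mkcond.
have disj k : ~~ (blocker I w w' k && blocker I w' w k).
  by apply/negP => /andP[/(blocker_disjoint w_hm w'_hm)/negP].
apply/eqP; rewrite -subr_eq0 -sum_z; apply/eqP.
apply: (signed_sums_eq0 _ _ z s) => [k l|k|k l|k l].
- by rewrite /z eq_sym setUC.
(* The half-matching that [k] blocks for attains the capacity, and the other one is bounded by it;
   this fixes the sign of the row sum. *)
- rewrite sum_z /s; have := disj k.
  case wk: (blocker I w w' k); case w'k: (blocker I w' w k) => //= _.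
  + rewrite subr0 mul1r (blocker_saturated w_hm wk) subr_ge0.
    by case: w'_hm.
  + rewrite sub0r mulN1r opprB (blocker_saturated w'_hm w'k) subr_ge0.
    by case: w_hm.
  + by rewrite subrr mul0r.
- rewrite /z; case: ifP => [lk|_]; last by rewrite mulr0.
  case: (ltgtP (w [set k; l]) (w' [set k; l])) => [lt|lt|->]; last first.
  + by rewrite subrr mulr0.
  (* Here [z k l > 0], so some endpoint is a blocker for [w']; by [disj] its sign is exactly -1, and
     the other sign is at most 1. What remains is a check over four booleans. *)
  + have := stable_blocker hw' w_hm lk lt; have := disj k; have := disj l.
    rewrite -subr_gt0 in lt; rewrite pmulr_lle0 // /s.
    by do 4![case: (blocker _ _ _ _)].
  + have := stable_blocker hw w'_hm lk lt; have := disj k; have := disj l.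
    rewrite -subr_lt0 in lt; rewrite nmulr_lle0 // /s.
    by do 4![case: (blocker _ _ _ _)].
(* Where [w] and [w'] differ, some endpoint is a blocker, and [disj] keeps the two indicators in its
   [s] from cancelling. *)
- rewrite /z; case: ifP => [lk|_]; last by rewrite eqxx.
  rewrite subr_eq0 neq_lt => /orP[lt|lt].
  + have := stable_blocker hw w'_hm lk lt; have := disj k; have := disj l.
    by rewrite /s; do 4![case: (blocker _ _ _ _)].
  + have := stable_blocker hw' w_hm lk lt; have := disj k; have := disj l.
    by rewrite /s; do 4![case: (blocker _ _ _ _)].
Qed.
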